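(* Let $F_m$ be the Fibonacci numbers ($F_0=0$, $F_1=1$, $F_m=F_{m-1}+F_{m-2}$ for all integers $m$, so $F_{-1}=1$), and let $d_0=1$ and for $n\ge1$, $d_{2n-1}=F_{2n-1}/F_{2n-3}$, $d_{2n}=1/d_{2n-1}$ (so $d=(1,1,1,2,\tfrac12,\tfrac52,\tfrac25,\tfrac{13}{5},\tfrac{5}{13},\ldots)$). Then, as formal power series in $x$, \[ \frac32-\frac12\sqrt{\frac{1-5x}{1-x}} = S(x;d_0,d_1,d_2,\ldots). \]
   Context: For a sequence $c=(c_0,c_1,\ldots)$, the S-fraction $S(x;c)$ is the formal power series \[ \cfrac{1}{1-\cfrac{c_0x}{1-\cfrac{c_1x}{1-\cdots}}}, \] understood as the $x$-adic limit of its finite truncations. The square root denotes the formal power series with constant term $1$. *)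

(* Defs.v *)
From HB Require Import structures.
From mathcomp Require Import all_boot all_order all_algebra.
From mathcomp Require Import boolp.

Set Implicit Arguments.
Unset Strict Implicit.
Unset Printing Implicit Defensive.

Import Order.TTheory GRing.Theory Num.Theory.
Local Open Scope ring_scope.

(* Course-of-values recursion: cov step n is the sequence of the first n
   values of the function u such that u n = step [:: u 0; ...; u (n - 1)]. *)
Definition cov (A : Type) (step : seq A -> A) (n : nat) : seq A :=
  iter n (fun s => rcons s (step s)) [::].

Lemma size_cov (A : Type) (step : seq A -> A) n : size (cov step n) = n.
Proof. by elim: n => //= n IHn; rewrite size_rcons IHn. Qed.

Lemma nth_cov (A : Type) (x0 : A) (step : seq A -> A) n i :
  (i < n)%N -> nth x0 (cov step n) i = step (cov step i).
Proof.
elim: n => //= n IHn; rewrite ltnS leq_eqVlt nth_rcons size_cov.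
by case/orP=> [/eqP->|lt_in]; rewrite ?ltnn ?eqxx // lt_in IHn.
Qed.

Arguments cov : simpl never.

(* Formal power series K[[x]]. *)
Record fps (K : fieldType) := Fps { fps_coef :> nat -> K }.

HB.instance Definition _ (K : fieldType) := gen_eqMixin (fps K).
HB.instance Definition _ (K : fieldType) := gen_choiceMixin (fps K).

Section FpsRing.
Variable K : fieldType.
Implicit Types f g h : fps K.

Lemma fpsP f g : (forall n, f n = g n) <-> f = g.
Proof.
split=> [eq_fg|-> //]; case: f g eq_fg => [f] [g] /= eq_fg.
by congr Fps; apply/funext.
Qed.

Definition fps0 : fps K := Fps (fun=> 0).
Definition fps1 : fps K := Fps (fun n => (n == 0%N)%:R).
Definition fps_opp f : fps K := Fps (fun n => - f n).
Definition fps_add f g : fps K := Fps (fun n => f n + g n).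
Definition fps_mul f g : fps K :=
  Fps (fun n => \sum_(i < n.+1) f i * g (n - i)%N).

Fact fps_addA : associative fps_add.
Proof. by move=> f g h; apply/fpsP => n /=; rewrite addrA. Qed.
Fact fps_addC : commutative fps_add.
Proof. by move=> f g; apply/fpsP => n /=; rewrite addrC. Qed.
Fact fps_add0 : left_id fps0 fps_add.
Proof. by move=> f; apply/fpsP => n /=; rewrite add0r. Qed.
Fact fps_addN : left_inverse fps0 fps_opp fps_add.
Proof. by move=> f; apply/fpsP => n /=; rewrite addNr. Qed.

HB.instance Definition _ := GRing.isZmodule.Build (fps K)
  fps_addA fps_addC fps_add0 fps_addN.

Let trunc f n : {poly K} := \poly_(i < n.+1) f i.

Let coef_trunc f n i : (i <= n)%N -> (trunc f n)`_i = f i.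
Proof. by move=> le_in; rewrite coef_poly ltnS le_in. Qed.

Let fps_mul_poly f g n (p q : {poly K}) :
    (forall i, (i <= n)%N -> p`_i = f i) ->
    (forall i, (i <= n)%N -> q`_i = g i) ->
  forall i, (i <= n)%N -> (p * q)`_i = fps_mul f g i.
Proof.
move=> eqp eqq i le_in; rewrite coefM; apply: eq_bigr => j _.
rewrite eqp; last by rewrite (leq_trans _ le_in) // -ltnS.
by rewrite eqq // (leq_trans (leq_subr _ _)).
Qed.

Fact fps_mulA : associative fps_mul.
Proof.
move=> f g h; apply/fpsP => n.
have tf := @coef_trunc f n; have tg := @coef_trunc g n.
have th := @coef_trunc h n.
rewrite -(fps_mul_poly tf (fps_mul_poly tg th)) // mulrA.
exact: (fps_mul_poly (fps_mul_poly tf tg) th).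
Qed.

Fact fps_mulC : commutative fps_mul.
Proof.
move=> f g; apply/fpsP => n.
have tf := @coef_trunc f n; have tg := @coef_trunc g n.
rewrite -(fps_mul_poly tf tg) // mulrC; exact: (fps_mul_poly tg tf).
Qed.

Fact fps_mul1 : left_id fps1 fps_mul.
Proof.
move=> f; apply/fpsP => n /=; rewrite big_ord_recl /= mul1r subn0 big1 ?addr0 //.
by move=> i _; rewrite mul0r.
Qed.

Fact fps_mulDl : left_distributive fps_mul fps_add.
Proof.
move=> f g h; apply/fpsP => n /=; rewrite -big_split.
by apply: eq_bigr => i _; rewrite /= mulrDl.
Qed.

Fact fps_1_neq0 : fps1 != 0.
Proof. by apply/eqP => /fpsP/(_ 0%N) /= /eqP; rewrite oner_eq0. Qed.

HB.instance Definition _ := GRing.Zmodule_isComNzRing.Build (fps K)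
  fps_mulA fps_mulC fps_mul1 fps_mulDl fps_1_neq0.

Lemma coef_fpsD f g n : (f + g) n = f n + g n. Proof. by []. Qed.
Lemma coef_fpsN f n : (- f) n = - f n. Proof. by []. Qed.
Lemma coef_fpsB f g n : (f - g) n = f n - g n. Proof. by []. Qed.
Lemma coef_fpsM f g n : (f * g) n = \sum_(i < n.+1) f i * g (n - i)%N.
Proof. by []. Qed.
Lemma coef_fps1 n : (1 : fps K) n = (n == 0%N)%:R. Proof. by []. Qed.

Lemma coef_fps_nat m n : (m%:R : fps K) n = if n == 0%N then m%:R else 0.
Proof.
elim: m => [|m IHm]; first by case: n.
by rewrite -natr1 coef_fpsD IHm coef_fps1; case: n {IHm} => [|n];
  rewrite ?natr1 //= addr0.
Qed.

Definition fpsX : fps K := Fps (fun n => (n == 1%N)%:R).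

Lemma coef_fpsXM f n : (fpsX * f) n = if n is m.+1 then f m else 0.
Proof.
rewrite coef_fpsM; case: n => [|n]; first by rewrite big_ord1 mul0r.
rewrite big_ord_recl /= mul0r add0r big_ord_recl /= mul1r subSS subn0.
by rewrite big1 ?addr0 // => i _; rewrite mul0r.
Qed.

Definition fpsC (a : K) : fps K := Fps (fun n => if n == 0%N then a else 0).

Lemma coef_fpsCM a f n : (fpsC a * f) n = a * f n.
Proof.
rewrite coef_fpsM big_ord_recl /= subn0 big1 ?addr0 // => i _.
by rewrite mul0r.
Qed.

(* The coefficient of x^n in f * g = 1 is solved for g n. *)
Definition fps_inv_step f (s : seq K) : K :=
  (f 0%N)^-1 * ((size s == 0%N)%:R - \sum_(i < size s) s`_i * f (size s - i)%N).

Definition fps_unit : pred (fps K) := fun f => f 0%N != 0.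

(* As for unitRingType in general, the inverse of a non-unit is itself. *)
Definition fps_inv f : fps K :=
  if fps_unit f then Fps (fun n => fps_inv_step f (cov (fps_inv_step f) n))
  else f.

Fact fps_mulVf : {in fps_unit, left_inverse 1 fps_inv *%R}.
Proof.
move=> f; rewrite unfold_in => uf; rewrite /fps_inv (uf : fps_unit f).
set g := Fps _; apply/fpsP => n; rewrite coef_fpsM big_ord_recr /= subnn.
rewrite [X in _ + X * _](_ : _ =
    (f 0%N)^-1 * ((n == 0%N)%:R - \sum_(i < n) g i * f (n - i)%N)).
  by rewrite [_^-1 * _]mulrC divfK // addrC subrK.
rewrite /fps_inv_step size_cov; congr (_ * (_ - _)).
by apply: eq_bigr => i _; rewrite nth_cov.
Qed.

Fact fps_unitPl f g : g * f = 1 -> fps_unit f.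
Proof.
move/fpsP/(_ 0%N); rewrite coef_fpsM big_ord1 /fps_unit /= => gf1.
by apply/eqP => f0; move/eqP: gf1; rewrite f0 mulr0 eq_sym oner_eq0.
Qed.

Fact fps_inv_out : {in [predC fps_unit], fps_inv =1 id}.
Proof. by move=> f nuf; rewrite /fps_inv ifN. Qed.

HB.instance Definition _ := GRing.ComNzRing_hasMulInverse.Build (fps K)
  fps_mulVf fps_unitPl fps_inv_out.

Lemma fps_unitE f : (f \is a GRing.unit) = (f 0%N != 0). Proof. by []. Qed.

(* The square root with constant term 1 of a series with constant term 1:
   the coefficient of x^n in g ^+ 2 = f is solved for g n (n > 0). *)
Definition fps_sqrt_step f (s : seq K) : K :=
  if size s == 0%N then 1 else
  (f (size s) - \sum_(1 <= i < size s) s`_i * s`_(size s - i)) / 2%:R.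

Definition fps_sqrt f : fps K :=
  Fps (fun n => fps_sqrt_step f (cov (fps_sqrt_step f) n)).

Lemma fps_sqrt_coef0 f : fps_sqrt f 0%N = 1. Proof. by []. Qed.

Lemma sqr_fps_sqrt f : 2%:R != 0 :> K -> f 0%N = 1 -> fps_sqrt f ^+ 2 = f.
Proof.
move=> nz2 f0; apply/fpsP => -[|n]; rewrite expr2 coef_fpsM.
  by rewrite big_ord1 fps_sqrt_coef0 mulr1 f0.
have: fps_sqrt f n.+1 = fps_sqrt_step f (cov (fps_sqrt_step f) n.+1) by [].
have: fps_sqrt f 0%N = 1 by [].
have: forall i, fps_sqrt f i = fps_sqrt_step f (cov (fps_sqrt_step f) i) by [].
move: (fps_sqrt f) => b bE b0 bn.
have {}bn: b n.+1 * 2%:R = f n.+1 - \sum_(i < n) b i.+1 * b (n - i)%N.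
  rewrite bn {1}/fps_sqrt_step size_cov /= divfK //.
  congr (_ - _); rewrite big_add1 big_mkord; apply: eq_bigr => i _.
  by rewrite !nth_cov ?subSS ?ltnS ?leq_subr // -!bE.
rewrite big_ord_recl big_ord_recr /= /bump /= !add1n subnn b0 mul1r mulr1.
by rewrite addrCA -mulr2n -mulr_natr bn addrC subrK.
Qed.

Lemma fps_sqrt_uniq f g :
  2%:R != 0 :> K -> g 0%N = 1 -> g ^+ 2 = f -> g = fps_sqrt f.
Proof.
move=> nz2 g0 gf; have f0: f 0%N = 1.
  by rewrite -gf expr2 coef_fpsM big_ord1 g0 mulr1.
have uD: g + fps_sqrt f \is a GRing.unit.
  by rewrite fps_unitE coef_fpsD g0 fps_sqrt_coef0.
apply/eqP; rewrite -subr_eq0 -(mulIr_eq0 _ (mulIr uD)) -subr_sqr.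
by rewrite gf sqr_fps_sqrt ?subrr.
Qed.

(* Convergence in the x-adic topology: u m = l modulo x ^ n for m large. *)
Definition xadic_cvg (u : nat -> fps K) (l : fps K) : Prop :=
  forall n, exists N, forall m, (N <= m)%N ->
    forall k, (k < n)%N -> u m k = l k.

Lemma xadic_cvg_uniq u l l' : xadic_cvg u l -> xadic_cvg u l' -> l = l'.
Proof.
move=> ul ul'; apply/fpsP => n.
have [[N uN] [N' uN']] := (ul n.+1, ul' n.+1).
by rewrite -(uN (maxn N N')) ?leq_maxl // uN' ?leq_maxr.
Qed.

(* The m-th truncation 1 / (1 - c_0 x / (1 - ... / (1 - c_(m-1) x))). *)
Fixpoint Sfrac_trunc (c : nat -> K) (m : nat) : fps K :=
  if m is m'.+1 then
    1 / (1 - fpsC (c 0%N) * fpsX * Sfrac_trunc (fun i => c i.+1) m')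
  else 1.

(* The coefficient of x^k is the same in all m-th truncations with k <= m. *)
Definition Sfrac (c : nat -> K) : fps K := Fps (fun k => Sfrac_trunc c k k).

Lemma Sfrac_unit a f : 1 - fpsC a * fpsX * f \is a GRing.unit.
Proof.
by rewrite fps_unitE coef_fpsB -mulrA coef_fpsCM coef_fpsXM mulr0 subr0 oner_eq0.
Qed.

Lemma Sfrac_stable c m m' k :
  (k <= m)%N -> (k <= m')%N -> Sfrac_trunc c m k = Sfrac_trunc c m' k.
Proof.
have eqn a f g n : (forall i, (i < n)%N -> f i = g i) -> forall i, (i <= n)%N ->
    (1 / (1 - fpsC a * fpsX * f)) i = (1 / (1 - fpsC a * fpsX * g)) i.
  move=> eq_fg; set p := 1 / _; set q := 1 / _.
  have recE r h i : r = 1 / (1 - fpsC a * fpsX * h) -> r i = (i == 0%N)%:R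
      + (if i is j.+1 then a * (h * r) j else 0).
    move=> rE; have: r * (1 - fpsC a * fpsX * h) = 1.
      by rewrite rE divrK // Sfrac_unit.
    rewrite mulrBr mulr1 => /eqP; rewrite subr_eq => /eqP {1}->.
    rewrite coef_fpsD coef_fps1 mulrC -!mulrA coef_fpsCM coef_fpsXM.
    by case: i => [|i] //; rewrite mulr0.
  elim/ltn_ind => -[|i] IHi le_in; rewrite (recE p f) ?(recE q g) //.
  congr (_ + _ * _); rewrite !coef_fpsM; apply: eq_bigr => j _.
  rewrite eq_fg; last by rewrite (leq_trans _ le_in).
  have lej: (i - j < i.+1)%N by rewrite ltnS leq_subr.
  by rewrite IHi // (leq_trans _ le_in) // ltnW.
have eq0 a f : (1 / (1 - fpsC a * fpsX * f)) 0%N = 1.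
  by rewrite (eqn a f 0 0%N) // mulr0 subr0 divr1.
elim: m m' k c => [|m IHm] [|m'] k c //.
- by rewrite leqn0 => /eqP-> _; exact: (esym (eq0 _ _)).
- by move=> _; rewrite leqn0 => /eqP->; exact: eq0.
move=> le_km le_km'; apply: (eqn _ _ _ k) => // i lt_ik.
by apply: IHm; rewrite -ltnS (leq_trans lt_ik).
Qed.

Lemma Sfrac_cvg c : xadic_cvg (Sfrac_trunc c) (Sfrac c).
Proof.
move=> n; exists n => m le_nm k lt_kn; apply: Sfrac_stable => //.
by rewrite (leq_trans (ltnW lt_kn)).
Qed.

End FpsRing.

(* fib2 n = (F_n, F_(n+1)) and fib2N n = (F_(-n), F_(-n+1)), the latter
   running F_m = F_(m-1) + F_(m-2) backwards. *)
Definition fib2 (n : nat) : int * int :=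
  iter n (fun p => (p.2, p.2 + p.1)) (0, 1).
Definition fib2N (n : nat) : int * int :=
  iter n (fun p => (p.2 - p.1, p.1)) (0, 1).

Definition fib (m : int) : int :=
  match m with Posz n => (fib2 n).1 | Negz n => (fib2N n.+1).1 end.

Lemma fib0 : fib 0 = 0. Proof. by []. Qed.
Lemma fib1 : fib 1 = 1. Proof. by []. Qed.

Lemma fib_pos n : fib n.+2 = fib n.+1 + fib n. Proof. by []. Qed.
Lemma fib_neg n : fib (- n.+2%:Z) = fib (- n%:Z) - fib (- n.+1%:Z).
Proof. by case: n. Qed.

Arguments fib : simpl never.

Lemma fib_rec (m : int) : fib m = fib (m - 1) + fib (m - 2).
Proof.
case: (intP m) => [|n|n]; first by [].
- case: n => [|n]; first by [].
  have ->: n.+2%:Z - 1 = n.+1 by rewrite -addn1 PoszD addrK.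
  have ->: n.+2%:Z - 2 = n by rewrite -addn2 PoszD addrK.
  exact: fib_pos.
- have ->: - n.+1%:Z - 1 = - n.+2%:Z by rewrite -opprD -PoszD addn1.
  have ->: - n.+1%:Z - 2 = - n.+3%:Z by rewrite -opprD -PoszD addn2.
  by rewrite (fib_neg n.+1) addrC subrK.
Qed.

(* d_0 = 1, d_(2n-1) = F_(2n-1) / F_(2n-3), d_(2n) = 1 / d_(2n-1). *)
Definition dodd (n : nat) : rat :=
  (fib (2 * n%:Z - 1))%:Q / (fib (2 * n%:Z - 3))%:Q.

Definition dseq (k : nat) : rat :=
  if k == 0%N then 1 else if odd k then dodd k.+1./2 else 1 / dodd k./2.

Lemma dseq0 : dseq 0%N = 1. Proof. by []. Qed.

Lemma dseq_odd n : (0 < n)%N ->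
  dseq (2 * n - 1) = (fib (2 * n%:Z - 1))%:Q / (fib (2 * n%:Z - 3))%:Q.
Proof.
case: n => // n _; rewrite mul2n doubleS subn1 /=.
by rewrite /dseq /= odd_double /= doubleK.
Qed.

Lemma dseq_even n : (0 < n)%N -> dseq (2 * n) = 1 / dseq (2 * n - 1).
Proof.
case: n => // n _; rewrite mul2n doubleS subn1 /=.
by rewrite /dseq /= odd_double /= doubleK.
Qed.

(* Main.v *)
(** The complete quotients [A_n = 1 / (1 - d_n x A_(n+1))] of the continued
    fraction are all quadratic over Q(x) with the discriminant (1 - x)(1 - 5x)
    up to squares.  With [e = d_(2k-1)], the quotient [A_(2k-1)] is a root of
      x ((3 - e) - (3 e - 1 - e^2) x) A^2 - (1 + (3 - 2 e) x) A + 1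
    and [A_(2k)] is a root of
      e^2 x A^2 - e (1 + (2 e - 3) x) A + e - (3 e - e^2 - 1) x.
    One step of the continued fraction sends the first equation to the second
    one, and the second one to the first one for [3 - 1/e], which is
    [d_(2k+1)] since F_(m+2) = 3 F_m - F_(m-2). *)
Require Import Defs.
From mathcomp Require Import all_boot all_order all_algebra.
From mathcomp Require Import ring zify.

Import GRing.Theory.
Local Open Scope ring_scope.

(** * Power series and complete quotients of S-fractions *)

Section PowerSeries.
Variable K : fieldType.

Lemma fpsCB (a b : K) : fpsC (a - b) = fpsC a - fpsC b.
Proof. by apply/fpsP => -[|n] //=; rewrite subr0. Qed.

Lemma fpsCM (a b : K) : fpsC (a * b) = fpsC a * fpsC b.
Proof.
by apply/fpsP => n; rewrite coef_fpsCM /=; case: eqP => //; rewrite mulr0.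
Qed.

Lemma fpsC_nat m : fpsC (m%:R : K) = m%:R.
Proof. by apply/fpsP => n; rewrite coef_fps_nat. Qed.

Lemma fpsC1 : fpsC (1 : K) = 1. Proof. exact: fpsC_nat 1%N. Qed.

Lemma fpsCV (a : K) : a != 0 -> fpsC a * fpsC (1 / a) = 1.
Proof. by move=> a0; rewrite -fpsCM mulrC divfK // fpsC1. Qed.

Lemma fpsXM_eq0 (f : fps K) : fpsX K * f = 0 -> f = 0.
Proof.
by move=> /fpsP Xf0; apply/fpsP => n; have := Xf0 n.+1; rewrite coef_fpsXM.
Qed.

Lemma coef0_fpsM (f g : fps K) : (f * g) 0%N = f 0%N * g 0%N.
Proof. by rewrite coef_fpsM big_ord1. Qed.

Lemma coef_fpsXn_mul (f : fps K) m k :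
  (k < m)%N -> (fpsX K ^+ m * f) k = 0.
Proof.
elim: m k => // m IHm [|k] lt_km; rewrite exprS -mulrA coef_fpsXM //.
exact: IHm.
Qed.

(** Since [f^-1] has constant term 1, [1 - f^-1] is divisible by [a x]; the quotient is [g]. *)
Lemma Sfrac_step_exists (a : K) (f : fps K) : a != 0 -> f 0%N = 1 ->
  exists g, f * (1 - fpsC a * fpsX K * g) = 1.
Proof.
move=> a0 f0; have uf : f \is a GRing.unit by rewrite fps_unitE f0 oner_eq0.
exists (Fps (fun n => - a^-1 * f^-1 n.+1)).
rewrite [X in f * X](_ : _ = f^-1) ?divrr //; apply/fpsP => -[|n].
  rewrite coef_fpsB -mulrA coef_fpsCM coef_fpsXM mulr0 subr0.
  have /fpsP/(_ 0%N) := divrr uf; rewrite coef0_fpsM f0 mul1r => ->.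
  by [].
rewrite coef_fpsB -mulrA coef_fpsCM coef_fpsXM coef_fps1 sub0r /=.
by rewrite mulNr mulrN opprK mulVKf.
Qed.

Lemma Sfrac_trunc_ext (c c' : nat -> K) m :
  c =1 c' -> Sfrac_trunc c m = Sfrac_trunc c' m.
Proof.
elim: m c c' => //= m IHm c c' cc'.
by rewrite cc' (IHm _ (fun i => c' i.+1)).
Qed.

(** A coinduction principle: [P n] is an invariant of the n-th complete quotient. Each unfolding
    step gains a factor [x], so a series satisfying [P n] agrees with the m-th truncation of the
    tail from [c n] modulo [x^(m+1)]. *)
Lemma Sfrac_coind (c : nat -> K) (P : nat -> fps K -> Prop) :
  (forall n f, P n f ->
     exists2 g, P n.+1 g & f * (1 - fpsC (c n) * fpsX K * g) = 1) ->
  forall f, P 0%N f -> f = Sfrac c.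
Proof.
move=> Pstep f P0f; apply/fpsP => k /=.
have approx m n g : P n g -> exists h,
    g - Sfrac_trunc (fun i => c (n + i)%N) m = fpsX K ^+ m.+1 * h.
  elim: m n g => [|m IHm] n g Pg; have [g' Pg' gE] := Pstep n g Pg.
    exists (fpsC (c n) * g' * g) => /=.
    by rewrite -[X in _ - X]gE expr1; ring.
  have [h hE] := IHm _ _ Pg'.
  rewrite (Sfrac_trunc_ext (fun i => c (n.+1 + i)%N) (fun i => c (n + i.+1)%N))
    in hE => [|i]; last by rewrite addnS.
  rewrite /= addn0; move: (Sfrac_trunc _ _) hE => t hE.
  set u := 1 - _ * t; set v := 1 / u.
  have uv : v * u = 1 by rewrite /v divrK // Sfrac_unit.
  exists (fpsC (c n) * h * g * v).
  (* Both inserted factors equal 1; the difference becomes [g * v] times the difference of the two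
     denominators, which contains [g' - t]. *)
  have -> : g - v = g * (v * u) - (g * (1 - fpsC (c n) * fpsX K * g')) * v.
    by rewrite uv gE; ring.
  rewrite exprS /u; transitivity (fpsC (c n) * fpsX K * (g' - t) * g * v).
    by ring.
  by rewrite hE; ring.
have [h /fpsP/(_ k)] := approx k 0%N f P0f.
by rewrite coef_fpsXn_mul // coef_fpsB => /eqP; rewrite subr_eq0 => /eqP.
Qed.

End PowerSeries.

(** * Fibonacci numbers of odd index and their ratios *)

Lemma fib_add2 (m : int) : fib (m + 2) = 3 * fib m - fib (m - 2).
Proof.
have e1 := fib_rec (m + 2); have e2 := fib_rec (m + 1); have e3 := fib_rec m.
have h1 : m + 2 - 1 = m + 1 by ring.
have h2 : m + 2 - 2 = m by ring.
have h3 : m + 1 - 1 = m by ring.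
have h4 : m + 1 - 2 = m - 1 by ring.
rewrite h1 h2 in e1; rewrite h3 h4 in e2; lia.
Qed.

Lemma fib_odd_rec n :
  fib (2 * n.+2%:Z - 1) = 3 * fib (2 * n.+1%:Z - 1) - fib (2 * n%:Z - 1).
Proof.
have -> : 2 * n.+2%:Z - 1 = (2 * n.+1%:Z - 1) + 2 by lia.
by rewrite fib_add2; congr (_ - fib _); lia.
Qed.

(** The recurrence [3 b - a] has a negative term, so positivity is proved together with
    monotonicity. *)
Lemma fib_odd_gt0 n : 0 < fib (2 * n%:Z - 1).
Proof.
suff: 0 < fib (2 * n%:Z - 1) /\ fib (2 * n%:Z - 1) <= fib (2 * n.+1%:Z - 1).
  by case.
elim: n => // n; rewrite fib_odd_rec; lia.
Qed.

Lemma doddS n :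
  dodd n.+1 = (fib (2 * n.+1%:Z - 1))%:Q / (fib (2 * n%:Z - 1))%:Q.
Proof. by rewrite /dodd; congr (_ / (fib _)%:Q); lia. Qed.

Lemma fib_oddQ_neq0 n : (fib (2 * n%:Z - 1))%:Q != 0.
Proof. by rewrite intr_eq0; have := fib_odd_gt0 n; lia. Qed.

Lemma dodd_neq0 n : dodd n.+1 != 0.
Proof. by rewrite doddS mulf_neq0 ?invr_eq0 ?fib_oddQ_neq0. Qed.

Lemma dodd_rec n : dodd n.+2 = 3 - 1 / dodd n.+1.
Proof.
rewrite !doddS fib_odd_rec intrB intrM.
have := fib_oddQ_neq0 n; have := fib_oddQ_neq0 n.+1.
by move: (fib _)%:~R (fib _)%:~R => a b b0 a0; field; rewrite a0.
Qed.

(** * Quadratic equations of the complete quotients *)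

Local Notation X := (fpsX rat).

Definition quotient_even (e : rat) (f : fps rat) : Prop :=
  let E := fpsC e in
  E ^+ 2 * X * f ^+ 2 - E * (1 + (2 * E - 3) * X) * f
    + (E - (3 * E - E ^+ 2 - 1) * X) = 0.

Definition quotient_odd (e : rat) (f : fps rat) : Prop :=
  let E := fpsC e in
  X * (3 - E - (3 * E - 1 - E ^+ 2) * X) * f ^+ 2
    - (1 + (3 - 2 * E) * X) * f + 1 = 0.

(** At [n = 0] the equation modulo [x] is [(f - 1) (f - 2) = 0], so the constant term selects the
    branch; for [n > 0] the equation itself forces constant term 1. *)
Definition quotient (n : nat) (f : fps rat) : Prop :=
  if n is n'.+1 then
    (if odd n' then quotient_even else quotient_odd) (dodd n'./2.+1) f
  else f 0%N = 1 /\ (1 - X) * f ^+ 2 - 3 * (1 - X) * f + (2 - X) = 0.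

(** The common shape of both quadratics modulo [x], with [a] equal to [e] or 1. *)
Lemma quotient_coef0 (a : rat) (f g : fps rat) : a != 0 ->
  fpsC a * (1 - f) + X * g = 0 -> f 0%N = 1.
Proof.
move=> a0 /fpsP/(_ 0%N); rewrite coef_fpsD coef_fpsCM coef_fpsXM addr0.
move=> /eqP; rewrite mulf_eq0 (negPf a0) coef_fpsB subr_eq0 => /eqP <-.
by [].
Qed.

Lemma quotient_even_coef0 e f : e != 0 -> quotient_even e f -> f 0%N = 1.
Proof.
move=> e0; rewrite /quotient_even /=; set E := fpsC e => Qf.
apply: (quotient_coef0 e _ (E ^+ 2 * f ^+ 2 - E * (2 * E - 3) * f
  - (3 * E - E ^+ 2 - 1))) => //.
by rewrite -[RHS]Qf -/E; ring.
Qed.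

Lemma quotient_odd_coef0 e f : quotient_odd e f -> f 0%N = 1.
Proof.
rewrite /quotient_odd /=; set E := fpsC e => Qf.
apply: (quotient_coef0 1 _ ((3 - E - (3 * E - 1 - E ^+ 2) * X) * f ^+ 2
  - (3 - 2 * E) * f)) => //.
by rewrite -[RHS]Qf fpsC1; ring.
Qed.

(** Substituting [f = 1/u] and clearing denominators by [u^2] turns the equation of [f] into [x]
    times that of [g]. *)
Lemma quotient_odd_step e f g :
  f * (1 - fpsC e * X * g) = 1 -> quotient_odd e f -> quotient_even e g.
Proof.
rewrite /quotient_odd /quotient_even /=; set E := fpsC e.
set u := 1 - _ => fu Qf; apply: fpsXM_eq0.
have -> : 0 = u ^+ 2 * 0 :> fps rat by rewrite mulr0.
rewrite -Qf; transitivity (X * (3 - E - (3 * E - 1 - E ^+ 2) * X) * (f * u) ^+ 2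
    - (1 + (3 - 2 * E) * X) * (f * u) * u + u ^+ 2); last by ring.
by rewrite fu /u; ring.
Qed.

Lemma quotient_even_step e f g : e != 0 -> f * (1 - fpsC (1 / e) * X * g) = 1 ->
  quotient_even e f -> quotient_odd (3 - 1 / e) g.
Proof.
move=> e0; rewrite /quotient_odd /quotient_even /= fpsCB (fpsC_nat _ 3).
have := fpsCV _ e e0; set E := fpsC e; set D := fpsC _ => ED.
set u := 1 - _ => fu Qf; apply: fpsXM_eq0.
have -> : 0 = u ^+ 2 * 0 :> fps rat by rewrite mulr0.
rewrite -Qf; transitivity (E ^+ 2 * X * (f * u) ^+ 2
    - E * (1 + (2 * E - 3) * X) * (f * u) * u
    + (E - (3 * E - E ^+ 2 - 1) * X) * u ^+ 2); last by ring.
(* Outside [u], the constants [E] and [D] are grouped into products [E * D], so that [E * D = 1] can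
   be rewritten between two uses of [ring]. *)
rewrite fu; transitivity (X * ((E * D) ^+ 2 * X ^+ 2 * g ^+ 2
    - (E * D) * u * g + 3 * (E * D) * X * u * g + u ^+ 2)).
  by rewrite ED /u; ring.
by rewrite /u; ring.
Qed.

Lemma quotient_step n f : quotient n f ->
  exists2 g, quotient n.+1 g & f * (1 - fpsC (dseq n) * X * g) = 1.
Proof.
case: n => [[f0 Qf]|n].
  have [g fg] := Sfrac_step_exists _ 1 f (oner_neq0 _) f0.
  exists g => //; rewrite /quotient /quotient_odd /=.
  have -> : dodd 1 = 1 by [].
  move: fg; rewrite fpsC1; set u := 1 - _ => fu; apply: fpsXM_eq0.
  have -> : 0 = u ^+ 2 * 0 :> fps rat by rewrite mulr0.
  rewrite -Qf; transitivity ((1 - X) * (f * u) ^+ 2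
    - 3 * (1 - X) * (f * u) * u + (2 - X) * u ^+ 2); last by ring.
  by rewrite fu /u; ring.
have e0 := dodd_neq0 n./2; rewrite /quotient /dseq /= uphalf_half.
(* The index is [n + 1]: for odd [n] the coefficient is [1/e] and [e] advances by [dodd_rec]; for
   even [n] it is [e], which is kept. *)
case: (odd n) => /= Qf.
  have [g fg] := Sfrac_step_exists _ _ f
    (mulf_neq0 (oner_neq0 _) (invr_neq0 e0)) (quotient_even_coef0 _ _ e0 Qf).
  exists g; last by rewrite add1n.
  by rewrite dodd_rec; apply: quotient_even_step fg Qf.
have [g fg] := Sfrac_step_exists _ _ f e0 (quotient_odd_coef0 _ _ Qf).
by exists g; rewrite ?add0n //; apply: quotient_odd_step fg Qf.
Qed.

Theorem theorem2p4 :
  fpsC (3 / 2 : rat)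
    - fpsC (1 / 2) * fps_sqrt ((1 - fpsC 5 * fpsX rat) / (1 - fpsX rat))
  = Sfrac dseq.
Proof.
apply: (Sfrac_coind _ _ quotient quotient_step).
set r := _ / (1 - X); have u1X : 1 - X \is a GRing.unit.
  by rewrite fps_unitE coef_fpsB subr0 oner_eq0.
have r1X : r * (1 - X) = 1 - 5 * X by rewrite divrK // (fpsC_nat _ 5).
have r0 : r 0%N = 1.
  have /fpsP/(_ 0%N) := r1X.
  by rewrite coef0_fpsM !coef_fpsB coef0_fpsM /= !mulr0 !subr0 mulr1.
have s2 := sqr_fps_sqrt (isT : 2%:R != 0 :> rat) r0.
have s0 := fps_sqrt_coef0 r.
move: (fps_sqrt r) s2 s0 => s s2 s0; split.
  by rewrite coef_fpsB coef_fpsCM s0.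
have -> : fpsC (3 / 2 : rat) = 3 * fpsC (1 / 2).
  by rewrite -(fpsC_nat _ 3) -fpsCM mul1r.
have := fpsCV _ (2 : rat) isT; rewrite (fpsC_nat _ 2).
set H := fpsC _ => H2; set f := 3 * H - H * s.
(* Factors [2 * H = 1] make the equation homogeneous of degree 2 in [H], so [H^2] factors out and
   leaves the equation of [s]. *)
transitivity ((1 - X) * f ^+ 2 - 3 * (1 - X) * f * (2 * H)
    + (2 - X) * (2 * H) ^+ 2); first by rewrite H2; ring.
transitivity (H ^+ 2 * (s ^+ 2 * (1 - X) - (1 - 5 * X))).
  by rewrite /f; ring.
by rewrite s2 r1X subrr mulr0.
Qed.
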